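(* Let $\{x^k\},\{\lambda^k\},\{w^k\},\{\rho_k\}$ be sequences generated by the augmented Lagrangian method (described in the context). Assume that (i) $F$ is bounded and pseudomonotone, (ii) the mappings $G:X\times X\to Y$ and $D_yG:X\times X\to L(X,Y)$ are completely continuous, and (iii) $x^{k+1}\in C$ and $\varepsilon^{k+1}-\mathcal{L}_{\rho_k}(x^{k+1},w^k)\in\mathcal{N}_C(x^{k+1})$ for all $k$, where $\{\varepsilon^k\}\subseteq X^*$ satisfies $\varepsilon^k\to0$. Let $\bar{x}$ be a weak limit point of $\{x^k\}$. Then $\bar{x}\in C$ and $-D_y(d_{\mathcal{K}}^2\circ G)(\bar{x},\bar{x})\in\mathcal{N}_C(\bar{x})$. If $\bar{x}$ satisfies the extended Robinson constraint qualification (ERCQ), then $\bar{x}$ is feasible, i.e. $\bar{x}\in C$ and $G(\bar{x},\bar{x})\in K$.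
   Context: Setting. $X,Y$ are real Banach spaces; $C\subseteq X$, $K\subseteq Y$ are nonempty closed convex sets; $F:X\to X^*$; $G:X\times X\to Y$ is Fréchet differentiable with respect to its second argument $y$, with derivative $D_yG(x,y)\in L(X,Y)$. $H$ is a real Hilbert space, $i:Y\hookrightarrow H$ is a continuous linear injection with dense range, and $\mathcal{K}\subseteq H$ is a closed convex set with $i^{-1}(\mathcal{K})=K$. Elements of $Y$ are identified with their images in $H$, and $\lambda\in H$ is identified with the element $y\mapsto(\lambda,i(y))_H$ of $Y^*$. $P_{\mathcal{K}}$ and $d_{\mathcal{K}}$ are the projection onto and distance to $\mathcal{K}$ in $H$; $D_y(d_{\mathcal{K}}^2\circ G)$ is the partial derivative with respect to $y$ of $(x,y)\mapsto d_{\mathcal{K}}(G(x,y))^2$. $\mathcal{N}_C(x)=\{\psi\in X^*:\langle\psi,s-x\rangle\le0\ \forall s\in C\}$ for $x\in C$. Augmented Lagrangian: for $x\in X$, $\lambda\in H$, $\rho>0$, $\mathcal{L}_\rho(x,\lambda):=F(x)+\rho D_yG(x,x)^*[G(x,x)+\lambda/\rho-P_{\mathcal{K}}(G(x,x)+\lambda/\rho)]\in X^*$. Also $V(x,\lambda,\rho):=\|G(x,x)-P_{\mathcal{K}}(G(x,x)+\lambda/\rho)\|_H$. Augmented Lagrangian method. Given $(x^0,\lambda^0)\in X\times H$, $\rho_0>0$, $\gamma>1$, $\tau\in(0,1)$ and a bounded set $B\subseteq H$, for $k=0,1,2,\dots$: choose $w^k\in B$; compute $x^{k+1}$ as an inexact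 solution of the variational inequality $x\in C$, $\langle\mathcal{L}_{\rho_k}(x,w^k),y-x\rangle\ge0$ for all $y\in C$ (the inexactness is that of hypothesis (iii)); set $\lambda^{k+1}:=\rho_k[G(x^{k+1},x^{k+1})+w^k/\rho_k-P_{\mathcal{K}}(G(x^{k+1},x^{k+1})+w^k/\rho_k)]$; if $k=0$ or $V(x^{k+1},w^k,\rho_k)\le\tau V(x^k,w^{k-1},\rho_{k-1})$, set $\rho_{k+1}:=\rho_k$, otherwise $\rho_{k+1}:=\gamma\rho_k$. The method is assumed not to terminate, so infinite sequences are generated. Bounded operator: maps bounded sets to bounded sets. Pseudomonotone (Brezis): $T:X\to X^*$ such that, whenever $x^k\rightharpoonup x$ and $\limsup_k\langle T(x^k),x^k-x\rangle\le0$, then $\langle T(x),x-y\rangle\le\liminf_k\langle T(x^k),x^k-y\rangle$ for all $y\in X$. Completely continuous: $z^k\rightharpoonup z$ implies $T(z^k)\to T(z)$ in norm. A weak limit point of a sequence is the weak limit of a subsequence. ERCQ holds in $x\in X$ (not necessarily feasible) if $0\in\operatorname{int}[G(x,x)+D_yG(x,x)(C-x)-K]$ (interior in $Y$). *)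

(* Defs.v *)
From HB Require Import structures.
From mathcomp Require Import all_boot all_order all_algebra.
From mathcomp Require Import all_classical all_reals all_analysis.

Set Implicit Arguments.
Unset Strict Implicit.
Unset Printing Implicit Defensive.

Import Order.TTheory GRing.Theory Num.Theory.
Import numFieldNormedType.Exports.

Local Open Scope classical_set_scope.
Local Open Scope ring_scope.

Section operators.
Context {R : realType}.
Implicit Types U V W : normedModType R.

(* Membership of the function f in L(U, V). *)
Definition bounded_linear_map U V (f : U -> V) : Prop :=
  linear f /\ continuous f.

(* The dual space U^* is L(U, R). *)
Definition dual U : set (U -> R) := [set psi | bounded_linear_map psi].

(* A real supremum: the operator norm for f in L(U, V), a junk value for
   functions that are unbounded on the unit ball. *)
Definition opnorm U V (f : U -> V) : R :=
  sup [set `|f h| | h in [set h | `|h| <= 1]].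

Definition weak_cvg U (u : nat -> U) (l : U) : Prop :=
  forall psi, dual psi -> psi (u k) @[k --> \oo] --> psi l.

Definition weak_limit_point U (u : nat -> U) (l : U) : Prop :=
  exists2 f : nat -> nat, increasing_seq f & weak_cvg (u \o f) l.

(* For U^*-valued maps, bounded sets and limits refer to the dual norm. *)
Definition bounded_operator U (T : U -> U -> R) : Prop :=
  forall A : set U, bounded_set A -> bounded_set [set opnorm (T x) | x in A].

Definition pseudomonotone U (T : U -> U -> R) : Prop :=
  forall (u : nat -> U) (x : U), weak_cvg u x ->
    (limn_esup (fun k => (T (u k) (u k - x))%:E) <= 0)%E ->
    forall y, ((T x (x - y))%:E <= limn_einf (fun k => (T (u k) (u k - y))%:E))%E.

Definition completely_continuous U V (T : U -> V) : Prop :=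
  forall (u : nat -> U) (l : U), weak_cvg u l -> T (u k) @[k --> \oo] --> T l.

(* The same property for a map T with values in L(V, W), normed by opnorm. *)
Definition completely_continuous_op U V W (T : U -> V -> W) : Prop :=
  forall (u : nat -> U) (l : U), weak_cvg u l ->
    opnorm (T (u k) \- T l) @[k --> \oo] --> (0 : R).

Definition normal_cone U (C : set U) (x : U) : set (U -> R) :=
  [set psi | dual psi /\ forall s, C s -> psi (s - x) <= 0].

Definition dist U (A : set U) (h : U) : R := inf [set `|h - a| | a in A].

(* Totalised with 0; the minimiser exists and is unique when A is a nonempty
   closed convex subset of a Hilbert space. *)
Definition proj U (A : set U) (h : U) : U :=
  xget 0 [set p | A p /\ forall a, A a -> `|h - p| <= `|h - a|].

(* The partial Frechet derivative of G : X * X -> Y in its second argument. *)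
Definition Dy U V (G : U * U -> V) (z : U * U) : U -> V :=
  'd (fun y : U => G (z.1, y)) (z.2 : U).

End operators.

Section augmented_lagrangian.
Context {R : realType} {X Y H : normedModType R}.
Variables (ip : {dot H for (idfun : R -> R)}) (i : Y -> H) (Kc : set H).
Variables (F : X -> X -> R) (G : X * X -> Y).

(* The element of Y^* identified with lam : H. *)
Definition dual_of_H (lam : H) : Y -> R := fun y => ip lam (i y).

(* G(x,x) + lam/rho, as an element of H. *)
Definition shifted (x : X) (lam : H) (rho : R) : H :=
  i (G (x, x)) + rho^-1 *: lam.

(* The adjoint of D is composition with D. *)
Definition aug_lagrangian (rho : R) (x : X) (lam : H) : X -> R := fun h =>
  F x h + rho * (dual_of_H (shifted x lam rho - proj Kc (shifted x lam rho))
                   \o Dy G (x, x)) h.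

Definition violation (x : X) (lam : H) (rho : R) : R :=
  `|i (G (x, x)) - proj Kc (shifted x lam rho)|.

(* The update rules of the method; the (inexact) subproblem condition on
   x k.+1 is stated separately. *)
Record alm_sequences (gamma tau : R) (B : set H)
    (x : nat -> X) (lam w : nat -> H) (rho : nat -> R) : Prop := AlmSequences {
  alm_rho0 : 0 < rho 0%N ;
  alm_w : forall k, B (w k) ;
  alm_lam : forall k, lam k.+1 =
    rho k *: (shifted (x k.+1) (w k) (rho k)
              - proj Kc (shifted (x k.+1) (w k) (rho k))) ;
  alm_rho : forall k, rho k.+1 =
    if (k == 0%N) || (violation (x k.+1) (w k) (rho k)
                      <= tau * violation (x k) (w k.-1) (rho k.-1))
    then rho k else gamma * rho k }.

Definition ERCQ (C : set X) (K : set Y) (x : X) : Prop :=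
  [set G (x, x) + Dy G (x, x) (c - x) - k | c in C & k in K]^° 0.

End augmented_lagrangian.

(* Main.v *)
Require Import Defs.
From HB Require Import structures.
From mathcomp Require Import all_boot all_order all_algebra.
From mathcomp Require Import all_classical all_reals all_analysis.
From mathcomp Require Import ring lra.

Set Implicit Arguments.
Unset Strict Implicit.
Unset Printing Implicit Defensive.

Import Order.TTheory GRing.Theory Num.Theory.
Import numFieldNormedType.Exports.

Local Open Scope classical_set_scope.
Local Open Scope ring_scope.

(** The argument first extracts from the limit xbar the variational inequality
      0 <= < z - P z , i (DG (c - xbar)) >   for all c in C,            (1)
    where z = i (G (xbar, xbar)), DG is the partial derivative at (xbar, xbar)
    and P is the projection onto Kc. Everything else is read off from (1):
    2 (z - P z) is the gradient of the squared distance at z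
    ([diff_sqr_dist]), so (1) is the normal cone condition; and if the
    constraint qualification writes 0 as z + i (DG (c - xbar)) - i k, then (1)
    and the variational inequality of the projection at i k force
    |z - P z|^2 <= 0, so that z = P z lies in Kc
    ([ERCQ_stationary_feasible]).

    To obtain (1), the penalty update leaves two possibilities
    ([penalty_dichotomy]). If rho is eventually constant, then the violations
    decay geometrically; as G is completely continuous, z is a limit of
    projections, hence z is in Kc and z - P z = 0. If rho tends to infinity,
    divide the inexact variational inequality by rho: the terms in F and eps
    vanish, because they are bounded along the bounded sequence of iterates,
    and the multiplier term passes to the limit as a pairing of a strongly
    convergent with a weakly convergent sequence ([vanishing_residual_limit]).

    This rests on classical facts about a normed space, proved below from a
    sublinear form of the Hahn-Banach theorem: closed convex sets are weakly
    closed ([closed_convex_weakly_closed]) and weakly convergent sequences are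
    bounded ([weak_cvg_bounded]). *)

(* The metric projection, not the coordinate projections of a product. *)
Local Notation proj := Defs.proj.

(** * The Hahn-Banach theorem for sublinear functionals *)

Section hahn_banach.
Context {R : realType}.

(** Homogeneity is only required as an inequality: the converse follows by
    scaling back, and the case of the zero scalar yields p 0 = 0. *)
Definition sublinear (V : lmodType R) (p : V -> R) : Prop :=
  (forall x y, p (x + y) <= p x + p y) /\
  (forall (a : R) x, 0 <= a -> p (a *: x) <= a * p x).

Section sublinear_theory.
Variable V : lmodType R.
Implicit Types p q : V -> R.

Lemma sublinear0 p : sublinear p -> p 0 = 0.
Proof.
move=> [pD pZ]; have := pZ 0 0 (lexx _); have := pD 0 0.
by rewrite scaler0 addr0 mul0r => h1 h2; lra.
Qed.

Lemma sublinear_ge p x : sublinear p -> - p (- x) <= p x.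
Proof.
by move=> sp; have := sp.1 x (- x); rewrite subrr sublinear0// => h; lra.
Qed.

(** The three sublinear functionals constructed below are all infima of families
    of numbers that are stable, up to decreasing, under addition and
    nonnegative scaling. *)
Lemma inf_sublinear (P : V -> set R) :
  (forall v, has_inf (P v)) ->
  (forall v w r s, P v r -> P w s -> exists2 t, P (v + w) t & t <= r + s) ->
  (forall (a : R) v r, 0 <= a -> P v r -> exists2 t, P (a *: v) t & t <= a * r) ->
  sublinear (fun v => inf (P v)).
Proof.
move=> Pinf PD PZ; split=> [v w|a v a0].
  rewrite /= -lerBlDr; apply: lb_le_inf; first exact: (Pinf v).1.
  move=> r Pr; rewrite lerBlDr -lerBlDl; apply: lb_le_inf.
    exact: (Pinf w).1.
  move=> s Ps; rewrite lerBlDl.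
  have [t Pt /(le_trans _)] := PD _ _ _ _ Pr Ps; apply.
  by apply: ge_inf => //; exact: (Pinf _).2.
rewrite /=; have [a00|a00] := eqVneq a 0.
  have [r Pr] := (Pinf v).1.
  have [t Pt] := PZ a v r a0 Pr; rewrite a00 !mul0r => t0.
  by apply: le_trans t0; apply: ge_inf; [exact: (Pinf _).2|rewrite -a00].
have a_gt0 : 0 < a by rewrite lt0r a00.
rewrite -ler_pdivrMl//; apply: lb_le_inf; first exact: (Pinf v).1.
move=> r Pr; rewrite ler_pdivrMl//.
have [t Pt /(le_trans _)] := PZ _ _ _ a0 Pr; apply.
by apply: ge_inf => //; exact: (Pinf _).2.
Qed.

(** The largest sublinear functional below p that is linear on the line spanned
    by y with the value p y at y. A sublinear functional that coincides with all
    its tilts is additive. *)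
Definition tilt p y (x : V) : R :=
  inf [set p (x + t *: y) - t * p y | t in [set t : R | 0 <= t]].

Let tilt_lb p y x : sublinear p ->
  lbound [set p (x + t *: y) - t * p y | t in [set t : R | 0 <= t]] (- p (- x)).
Proof.
move=> [pD pZ] _ [t /= t0 <-].
have sp : sublinear p by [].
have h1 := pD (x + t *: y) (- x); rewrite addrAC subrr add0r in h1.
have h2 := pZ t^-1 (t *: y).
have [t00|t00] := eqVneq t 0.
  by rewrite t00 scale0r mul0r addr0 subr0; exact: sublinear_ge.
move: h2; rewrite scalerA mulVf// scale1r invr_ge0 => /(_ t0).
by rewrite ler_pdivlMl ?lt0r ?t00// => h2; lra.
Qed.

Lemma tilt_sublinear p y : sublinear p -> sublinear (tilt p y).
Proof.
move=> sp; have [pD pZ] := sp; apply: inf_sublinear.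
- move=> v; split; last by exists (- p (- v)); exact: tilt_lb.
  by exists (p (v + 0 *: y) - 0 * p y); exists 0 => /=.
- move=> v w _ _ [s /= s0 <-] [t /= t0 <-].
  exists (p (v + w + (s + t) *: y) - (s + t) * p y).
    by exists (s + t) => //=; exact: addr_ge0.
  have := pD (v + s *: y) (w + t *: y).
  by rewrite [X in p X <= _]addrACA -scalerDl => h; lra.
- move=> a v _ a0 [t /= t0 <-].
  exists (p (a *: v + (a * t) *: y) - (a * t) * p y).
    by exists (a * t) => //=; exact: mulr_ge0.
  by rewrite -scalerA -scalerDr mulrBr -mulrA lerD2r pZ.
Qed.

Lemma tilt_le p y x t : sublinear p -> 0 <= t ->
  tilt p y x <= p (x + t *: y) - t * p y.
Proof.
move=> sp t0; apply: ge_inf; first by exists (- p (- x)); exact: tilt_lb.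
by exists t.
Qed.

(** Minimality gives p = tilt p y for every y, and tilt p y x is at most
    p (x + y) - p y, which is the missing half of additivity. *)
Lemma minimal_sublinear_linear p : sublinear p ->
  (forall q, sublinear q -> (forall x, q x <= p x) -> q = p) ->
  scalar p.
Proof.
move=> sp pmin; have [pD pZ] := sp.
have tiltE y : tilt p y = p.
  apply: pmin => [|x]; first exact: tilt_sublinear.
  have := tilt_le y x sp (lexx 0).
  by rewrite scale0r addr0 mul0r subr0.
have pDE x y : p (x + y) = p x + p y.
  apply/eqP; rewrite eq_le pD/= -lerBrDr -{1}(tiltE y).
  by have := tilt_le y x sp ler01; rewrite scale1r mul1r.
have pN x : p (- x) = - p x.
  by apply/eqP; rewrite -addr_eq0 -pDE addNr sublinear0.
have pZE a x : 0 <= a -> p (a *: x) = a * p x.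
  move=> a0; apply/eqP; rewrite eq_le pZ//=.
  by have := pZ a (- x) a0; rewrite scalerN !pN mulrN lerN2.
move=> a x y; rewrite pDE; congr +%R; have [/pZE//|a0] := leP 0 a.
by rewrite -[in LHS](opprK a) scaleNr pN pZE ?oppr_ge0 1?ltW// mulNr opprK.
Qed.

(** Zorn's lemma on the sublinear functionals below p, ordered downwards, gives
    a minimal one, which is linear. *)
Theorem hahn_banach p : sublinear p ->
  exists2 f : V -> R, scalar f & forall x, f x <= p x.
Proof.
move=> sp.
pose D q := sublinear q /\ forall x, q x <= p x.
pose T := {q : V -> R | D q}.
pose ord (s t : T) := `[< forall x, sval t x <= sval s x >].
have [||[q1 h1] [q2 h2]|A Atot|[f [sf fp]] fmin] := @Zorn T ord.
- by move=> t; apply/asboolP.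
- move=> r s t /asboolP rs /asboolP st; apply/asboolP => x.
  exact: le_trans (rs x).
- move=> /asboolP/= q21 /asboolP/= q12; apply: eq_exist => /=.
  by apply/funext => x; apply/eqP; rewrite eq_le q12 q21.
- have [[q0 Aq0]|A0] := pselect (A !=set0); last first.
    have pp : D p by [].
    by exists (exist D p pp) => s As; exfalso; apply: A0; exists s.
  pose P v := [set sval q v | q in A].
  have Plb v : has_inf (P v).
    split; first by exists (sval q0 v); exists q0.
    exists (- p (- v)) => _ [[q [sq qp]] _ <-] /=.
    by apply: le_trans (sublinear_ge v sq); rewrite lerN2.
  have sP : sublinear (fun v => inf (P v)).
    apply: inf_sublinear => //.
    + move=> v w _ _ [q Aq <-] [q' Aq' <-].
      have [/asboolP qq'|/asboolP qq'] := Atot _ _ Aq Aq'.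
      * exists (sval q' (v + w)); first by exists q'.
        have [[qD _] _] := svalP q'.
        by apply: le_trans (qD _ _) _; rewrite lerD2r.
      * exists (sval q (v + w)); first by exists q.
        have [[qD _] _] := svalP q.
        by apply: le_trans (qD _ _) _; rewrite lerD2l.
    + move=> a v _ a0 [q Aq <-]; exists (sval q (a *: v)); first by exists q.
      by have [[_ qZ] _] := svalP q; exact: qZ.
  have iP (q : T) v : A q -> inf (P v) <= sval q v.
    by move=> Aq; apply: ge_inf; [exact: (Plb v).2|exists q].
  have Pp v : inf (P v) <= p v.
    by apply: le_trans (iP _ v Aq0) _; have [_] := svalP q0.
  by exists (exist D _ (conj sP Pp)) => q Aq; apply/asboolP => x /=; exact: iP.
- exists f => //; apply: minimal_sublinear_linear => // q sq qf.
  have qp : D q.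
    by split=> // x; exact: le_trans (fp x).
  suff /(congr1 sval) : exist D q qp = exist D f (conj sf fp) :> T by [].
  by apply: fmin; apply/asboolP.
Qed.

End sublinear_theory.
End hahn_banach.

(** * Bounded linear maps, separation and weak closedness *)

Section functionals.
Context {R : realType}.
Implicit Types V W : normedModType R.

Lemma convex_comb (V : lmodType R) (C : set V) (a b : V) (s t : R) :
  convex_set C -> C a -> C b -> 0 <= s -> 0 <= t -> s + t = 1 ->
  C (s *: a + t *: b).
Proof.
move=> cC Ca Cb s0 t0 st1.
have s1 : s <= 1 by lra.
have := cC a b (Itv01 s0 s1) (mem_set Ca) (mem_set Cb).
rewrite inE /conv /=.
by rewrite (_ : t = 1 - s)//; lra.
Qed.

Lemma bounded_linear_mapP V W (f : V -> W) (M : R) :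
  linear f -> (forall v, `|f v| <= M * `|v|) -> bounded_linear_map f.
Proof.
move=> lf fM; split=> //.
pose L : {linear V -> W} := HB.pack f (GRing.isLinear.Build _ _ _ _ f lf).
apply: (@bounded_linear_continuous _ _ _ L); apply/bounded_funP => r.
exists (`|M| * `|r|) => x xr /=; apply: le_trans (fM x) _.
apply: le_trans (ler_norm _) _; rewrite normrM normr_id ler_wpM2l//.
exact: le_trans xr (ler_norm _).
Qed.

Section bounded_linear_map_theory.
Context {V W : normedModType R}.
Variable f : V -> W.
Hypothesis bf : bounded_linear_map f.

Lemma blmap0 : f 0 = 0.
Proof. by have := bf.1 (-1) 0 0; rewrite scaler0 addr0 scaleN1r addNr. Qed.

Lemma blmapD x y : f (x + y) = f x + f y.
Proof. by have := bf.1 1 x y; rewrite !scale1r. Qed.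

Lemma blmapZ a x : f (a *: x) = a *: f x.
Proof. by have := bf.1 a x 0; rewrite blmap0 !addr0. Qed.

Lemma blmapN x : f (- x) = - f x.
Proof. by rewrite -scaleN1r blmapZ scaleN1r. Qed.

Lemma blmapB x y : f (x - y) = f x - f y.
Proof. by rewrite blmapD blmapN. Qed.

Lemma blmap_lipschitz : exists2 k, 0 < k & forall x, `|f x| <= k * `|x|.
Proof.
pose L : {linear V -> W} := HB.pack f (GRing.isLinear.Build _ _ _ _ f bf.1).
exact: (@linear_lipschitz _ _ _ L bf.2).
Qed.

Let opnorm_has_sup : has_sup [set `|f h| | h in [set h | `|h| <= 1]].
Proof.
split; first by exists `|f 0|; exists 0 => //=; rewrite normr0.
have [k k0 fk] := blmap_lipschitz; exists k => _ [h /= h1 <-].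
by apply: le_trans (fk h) _; rewrite ler_piMr// ltW.
Qed.

Lemma opnorm_ge0 : 0 <= opnorm f.
Proof.
have : `|f 0| <= opnorm f.
  apply: ub_le_sup; first exact: opnorm_has_sup.2.
  by exists 0 => //=; rewrite normr0.
exact: le_trans.
Qed.

Lemma le_opnorm x : `|f x| <= opnorm f * `|x|.
Proof.
have [->|x0] := eqVneq x 0; first by rewrite blmap0 !normr0 mulr0.
rewrite -ler_pdivrMr ?normr_gt0// mulrC.
rewrite -[X in X * _ <= _]ger0_norm ?invr_ge0// -normrZ -blmapZ.
apply: ub_le_sup; first exact: opnorm_has_sup.2.
by eexists; last reflexivity; rewrite /= normrZ normfV normr_id mulVf// normr_eq0.
Qed.

End bounded_linear_map_theory.

Lemma blmap_comp (U V W : normedModType R) (f : U -> V) (g : V -> W) :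
  bounded_linear_map f -> bounded_linear_map g -> bounded_linear_map (g \o f).
Proof.
move=> bf bg; split=> [a x y|x].
  by rewrite /= (blmapD bf) (blmapZ bf) (blmapD bg) (blmapZ bg).
exact: (continuous_comp (bf.2 x) (bg.2 (f x))).
Qed.

Lemma blmapB_fun V W (f g : V -> W) :
  bounded_linear_map f -> bounded_linear_map g -> bounded_linear_map (f \- g).
Proof.
move=> bf bg; split=> [a x y|x].
  rewrite /= (blmapD bf) (blmapZ bf) (blmapD bg) (blmapZ bg).
  by rewrite scalerBr opprD addrACA.
by apply: cvgB; [exact: bf.2|exact: bg.2].
Qed.

(** A linear f below the sublinear functional
      p v = inf { |v - t (c - x)| - t d : t >= 0, c in C }
    satisfies f <= |.| (take t = 0) and f (c - x) <= - d (take t = 1). Convexity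
    of C makes p subadditive and the distance hypothesis makes it finite. *)
Theorem convex_separation V (C : set V) (d : R) (x : V) :
  C !=set0 -> convex_set C -> (forall c, C c -> d <= `|c - x|) ->
  exists f : V -> R, [/\ dual f, forall v, `|f v| <= `|v| &
    forall c, C c -> f (c - x) <= - d].
Proof.
move=> [c0 Cc0] cC Cd.
pose P v : set R :=
  [set r | exists t c, [/\ 0 <= t, C c & r = `|v - t *: (c - x)| - t * d]].
have Plb v : lbound (P v) (- `|v|).
  move=> _ [t [c [t0 Cc ->]]].
  have := lerB_dist (t *: (c - x)) v; rewrite distrC normrZ ger0_norm//.
  by have := ler_wpM2l t0 (Cd c Cc) => h1 h2; lra.
have coneD s t a b : 0 <= s -> 0 <= t -> C a -> C b ->
    exists2 c, C c & (s + t) *: (c - x) = s *: (a - x) + t *: (b - x).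
  move=> s0 t0 Ca Cb; have [st0|st0] := eqVneq (s + t) 0.
    have [-> ->] : s = 0 /\ t = 0 by split; lra.
    by exists a => //; rewrite addr0 !scale0r addr0.
  exists ((s / (s + t)) *: a + (t / (s + t)) *: b).
    apply: convex_comb => //; rewrite ?divr_ge0 ?addr_ge0//.
    by rewrite -mulrDl divff.
  rewrite !scalerBr scalerDr !scalerA ![(s + t) * _]mulrC !divfK//.
  by rewrite scalerDl opprD addrACA.
have sp : sublinear (fun v => inf (P v)).
  apply: inf_sublinear.
  - move=> v; split; last by exists (- `|v|); exact: Plb.
    by exists (`|v - 0 *: (c0 - x)| - 0 * d), 0, c0.
  - move=> v w _ _ [s [a [s0 Ca ->]]] [t [b [t0 Cb ->]]].
    have [c Cc cE] := coneD _ _ _ _ s0 t0 Ca Cb.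
    exists (`|v + w - (s + t) *: (c - x)| - (s + t) * d).
      by exists (s + t), c; split=> //; exact: addr_ge0.
    have := ler_normD (v - s *: (a - x)) (w - t *: (b - x)).
    by rewrite cE [X in `|X| <= _]addrACA -opprD => h; lra.
  - move=> k v _ k0 [t [c [t0 Cc ->]]].
    exists (`|k *: v - (k * t) *: (c - x)| - (k * t) * d).
      by exists (k * t), c; split=> //; exact: mulr_ge0.
    by rewrite -scalerA -scalerBr normrZ ger0_norm// mulrBr mulrA.
have [f lf fp] := hahn_banach sp.
have Pinf v r : P v r -> f v <= r.
  move=> Pr; apply: le_trans (fp v) _; apply: ge_inf => //.
  by exists (- `|v|); exact: Plb.
have f_le v : f v <= `|v|.
  by apply: Pinf; exists 0, c0; rewrite scale0r subr0 mul0r subr0.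
have f_norm v : `|f v| <= `|v|.
  rewrite ler_norml f_le andbT -[f v]opprK lerN2 -normrN.
  suff -> : - f v = f (- v) by [].
  have f0 : f 0 = 0 by have := lf (-1) 0 0; rewrite scaler0 addr0 mulN1r addNr.
  by have := lf (-1) v 0; rewrite f0 !addr0 scaleN1r mulN1r.
exists f; split=> //.
  by apply: (@bounded_linear_mapP _ _ _ 1) => // v; rewrite mul1r.
move=> c Cc; apply: Pinf; exists 1, c; split=> //.
by rewrite scale1r subrr normr0 mul1r sub0r.
Qed.

(** Separate x from the origin. *)
Corollary norming_functional V (x : V) :
  exists f : V -> R, [/\ dual f, forall v, `|f v| <= `|v| & f x = `|x|].
Proof.
have [|||f [df f1 /(_ 0 erefl)]] := @convex_separation V [set 0] `|x| x.
- by exists 0.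
- by move=> a b t; rewrite !inE => -> ->; rewrite convmm.
- by move=> _ ->; rewrite sub0r normrN.
rewrite sub0r (blmapN df) lerN2 => fx; exists f; split=> //.
by apply/eqP; rewrite eq_le fx (le_trans (ler_norm _)).
Qed.

(** Mazur: a functional that separates l from C by a positive gap keeps that gap
    along the sequence. *)
Theorem closed_convex_weakly_closed V (C : set V) (u : nat -> V) (l : V) :
  closed C -> convex_set C -> (forall n, C (u n)) -> weak_cvg u l -> C l.
Proof.
move=> clC cC Cu ul; apply: contrapT => nCl.
have : nbhs l (~` C) by apply: open_nbhs_nbhs; split=> //; exact: closed_openC.
move=> /nbhs_ballP[d /= d0 dC].
have [||c Cc|f [df _ fC]] := @convex_separation V C d l.
- by exists (u 0%N).
- exact: cC.
- rewrite leNgt; apply/negP => cd; apply: (dC c) => //.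
  by rewrite -ball_normE /= distrC.
have fu : f (u n) @[n --> \oo] --> f l by exact: ul.
have : f l <= f l - d.
  apply: (cvgr_to_le fu); apply: nearW => n.
  by have := fC _ (Cu n); rewrite (blmapB df) => h; lra.
by move=> h; lra.
Qed.

End functionals.

(** * Boundedness of weakly convergent sequences *)

Section weak_convergence.
Context {R : realType}.
Implicit Types V W : normedModType R.

Lemma le_geometric_le0 (z q M : R) :
  `|q| < 1 -> (forall n, z <= q ^+ n * M) -> z <= 0.
Proof.
move=> q1 zM; have qM : q ^+ n * M @[n --> \oo] --> 0 * M.
  by apply: cvgM; [exact: cvg_expr|exact: cvg_cst].
rewrite -(mul0r M); apply: (cvgr_to_ge qM); exact: nearW.
Qed.

Lemma bounded_near_ex (T : Type) V (h : T -> V) (A : set T) :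
  [bounded h t | t in A] -> exists M, forall t, A t -> `|h t| <= M.
Proof. by move=> [M [_ hM]]; exists (M + 1); apply: hM; rewrite ltrDl. Qed.

(** The gliding hump: for phi n of norm at most 1, psi (n+1) adds to psi n a term
    of norm at most 3^-n, with the sign that makes it reinforce psi n at y n. *)
Definition hump V (y : nat -> V) (phi : nat -> V -> R) : nat -> V -> R :=
  fix psi n := if n is m.+1 then
    fun v => psi m v + (-1) ^+ (psi m (y m) < 0)%R * 3^-1 ^+ m * phi m v
  else fun=> 0.

Section hump_theory.
Variables (V : normedModType R) (y : nat -> V) (phi : nat -> V -> R).
Hypothesis phi_dual : forall n, dual (phi n).
Hypothesis phi_le : forall n v, `|phi n v| <= `|v|.
Hypothesis phi_y : forall n, phi n (y n) = `|y n|.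
Let psi := hump y phi.

Let q_ge0 n : 0 <= 3^-1 ^+ n :> R. Proof. by rewrite exprn_ge0 ?invr_ge0. Qed.

Let hump_step n v : `|psi n.+1 v - psi n v| <= 3^-1 ^+ n * `|v|.
Proof.
rewrite /= addrAC subrr add0r !normrM normrX normrN1 expr1n mul1r.
by rewrite ger0_norm// ler_wpM2l.
Qed.

Lemma hump_big n : 3^-1 ^+ n * `|y n| <= `|psi n.+1 (y n)|.
Proof.
rewrite /= -/psi phi_y; have := mulr_ge0 (q_ge0 n) (normr_ge0 (y n)).
case: ltP => psi0 h; rewrite ?expr0 ?expr1 ?mulN1r ?mul1r.
  by rewrite ltr0_norm; lra.
by rewrite ger0_norm; lra.
Qed.

Lemma hump_linear n : scalar (psi n).
Proof.
elim: n => [|n IH] a x z /=; first by rewrite mulr0 addr0.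
rewrite IH (blmapD (phi_dual n)) (blmapZ (phi_dual n)).
by set k := _ ^+ _ * _; rewrite -[_ *: _]/(_ * _); ring.
Qed.

(** The sum of 3^-m over m >= n is 3/2 * 3^-n. Subtracting or adding this tail,
    times |v|, turns psi n v into a monotone sequence, so the limit is a
    supremum and lies between both sequences. *)
Lemma hump_limit : exists f : V -> R,
  dual f /\ forall n v, `|f v - psi n v| <= 3 / 2 * 3^-1 ^+ n * `|v|.
Proof.
pose a v n := psi n v - 3 / 2 * 3^-1 ^+ n * `|v|.
pose b v n := psi n v + 3 / 2 * 3^-1 ^+ n * `|v|.
have ab v n : a v n <= b v n.
  by have := mulr_ge0 (q_ge0 n) (normr_ge0 v); rewrite /a /b => h; lra.
have a_nd v : nondecreasing_seq (a v).
  apply/nondecreasing_seqP => n; have := hump_step n v.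
  by rewrite ler_norml /a exprS => /andP[h1 h2]; lra.
have b_ni v : nonincreasing_seq (b v).
  apply/nonincreasing_seqP => n; have := hump_step n v.
  by rewrite ler_norml /b exprS => /andP[h1 h2]; lra.
have a_le_b v m n : a v m <= b v n.
  apply: le_trans (a_nd v _ _ (leq_maxl m n)) _.
  by apply: le_trans (ab v _) _; exact: b_ni (leq_maxr m n).
pose f v := sup (range (a v)).
have fpsi n v : `|f v - psi n v| <= 3 / 2 * 3^-1 ^+ n * `|v|.
  have fb : f v <= b v n.
    by apply: ge_sup => [|_ [m _ <-] //]; exists (a v 0%N), 0%N.
  have fa : a v n <= f v.
    by apply: ub_le_sup; [exists (b v n) => _ [m _ <-]|exists n].
  move: fa fb; rewrite ler_norml /a /b => h1 h2.
  by apply/andP; split; lra.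
exists f; split=> //; apply: (@bounded_linear_mapP _ _ _ _ (3 / 2)); last first.
  by move=> v; have := fpsi 0%N v; rewrite /= subr0 expr0 mulr1.
move=> c x z; apply/eqP; rewrite -subr_eq0 -normr_le0.
apply: (@le_geometric_le0 _ 3^-1
  (3 / 2 * (`|c *: x + z| + `|c| * `|x| + `|z|))) => [|n].
  by rewrite ger0_norm; lra.
have h1 := fpsi n (c *: x + z); have h3 := fpsi n z.
have h2 := ler_wpM2l (normr_ge0 c) (fpsi n x); rewrite -normrM in h2.
have -> : f (c *: x + z) - (c *: f x + f z) =
    (f (c *: x + z) - psi n (c *: x + z)) - c * (f x - psi n x) - (f z - psi n z).
  by rewrite hump_linear -[c *: f x]/(c * f x); ring.
apply: le_trans (ler_normB _ _) _.
have := ler_normB (f (c *: x + z) - psi n (c *: x + z)) (c * (f x - psi n x)).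
by move=> h4; lra.
Qed.

End hump_theory.

(** Uniform boundedness principle for evaluations on the dual. If |y n| >= 4^n
    along terms y n of u, the limit f of the humps built on norming functionals
    of the y n satisfies
      |f (y n)| >= 3^-n |y n| - 3/2 * 3^-(n+1) |y n| >= (4/3)^n / 2,
    although f is bounded along u. *)
Theorem weak_cvg_bounded V (u : nat -> V) (l : V) : weak_cvg u l ->
  exists M, forall n, `|u n| <= M.
Proof.
move=> ul; apply: contrapT => unb.
have {}unb n : {k | 4 ^+ n <= `|u k|}.
  apply: cid; apply: contrapT => h; apply: unb; exists (4 ^+ n) => k.
  by rewrite leNgt; apply/negP => /ltW uk; apply: h; exists k.
pose y n := u (sval (unb n)).
have [phi phiP] := choice (fun n => norming_functional (y n)).
have phi_dual n : dual (phi n) by have [] := phiP n.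
have phi_le n v : `|phi n v| <= `|v| by have [] := phiP n.
have phi_y n : phi n (y n) = `|y n| by have [] := phiP n.
have [f [df fpsi]] := @hump_limit V y phi phi_dual phi_le.
have fu : f (u n) @[n --> \oo] --> f l by exact: ul.
have /cvg_seq_bounded/bounded_near_ex[M fM] := cvgP _ fu.
suff : 1 <= 0 :> R by rewrite ler10.
apply: (@le_geometric_le0 1 (3 / 4) (2 * M)) => [|n].
  by rewrite ger0_norm; lra.
have h1 := hump_big phi_y n; have h2 := fpsi n.+1 (y n).
have h3 := fM (sval (unb n)) I; have h4 := svalP (unb n).
rewrite -/(y n) /= in h2 h3 h4.
have h5 : `|hump y phi n.+1 (y n)| <=
    `|f (y n)| + `|f (y n) - hump y phi n.+1 (y n)|.
  by rewrite -[X in `|X| <= _](subKr (f (y n))); exact: ler_normB.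
have q_gt0 : 0 < 3^-1 ^+ n :> R by rewrite exprn_gt0 ?invr_gt0.
have h6 : 3^-1 ^+ n * 4 ^+ n <= 2 * M.
  apply: le_trans (ler_wpM2l (ltW q_gt0) h4) _.
  by move: h2; rewrite exprS => h2; lra.
rewrite [leLHS](_ : 1 = (3 / 4) ^+ n * (3^-1 ^+ n * 4 ^+ n)); last first.
  by rewrite -!exprMn (_ : _ * _ = 1) ?expr1n//; field.
by rewrite ler_wpM2l// exprn_ge0//; lra.
Qed.

End weak_convergence.

(** * Projection onto a closed convex subset of a Hilbert space *)

Lemma differentiable_quadratic_remainder (R : realType) (U V : normedModType R)
    (f : U -> V) (D : U -> V) (x : U) (M : R) :
  bounded_linear_map D ->
  (forall h, `|f (h + x) - f x - D h| <= M * `|h| ^+ 2) ->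
  differentiable f x /\ 'd f x = D :> (U -> V).
Proof.
move=> bD fM.
pose L : {linear U -> V} := HB.pack D (GRing.isLinear.Build _ _ _ _ D bD.1).
have fL : f \o shift x = cst (f x) + L +o_ 0 id.
  apply/eqaddoP => e e0.
  have M1_gt0 : 0 < `|M| + 1 by rewrite ltr_wpDl.
  near=> h.
  rewrite (_ : _ h = f (h + x) - f x - D h); last first.
    by rewrite !fctE opprD addrA.
  apply: le_trans (fM h) _; rewrite expr2 mulrA ler_wpM2r//.
  have /ltW he : `|h| < e / (`|M| + 1).
    near: h; apply: nbhs0_lt; exact: divr_gt0.
  rewrite ler_pdivlMr// in he; apply: le_trans he.
  rewrite mulrC ler_wpM2l//; apply: le_trans (ler_norm _) _; by rewrite lerDl.
have dE : 'd f x = L :> (U -> V) by apply: diff_unique => //; exact: bD.2.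
split=> //; apply/diff_locallyP; rewrite dE; split=> //; exact: bD.2.
Unshelve. all: by end_near. Qed.

Section hilbert_projection.
Context {R : realType} {H : completeNormedModType R}.
Variable ip : {dot H for (idfun : R -> R)}.
Hypothesis ip_norm : forall h : H, ip h h = `|h| ^+ 2.
Implicit Types a b h u v : H.

Lemma ipC a b : ip a b = ip b a.
Proof. by rewrite hermitian_subproof expr0 mul1r. Qed.

Lemma ipDl u a b : ip (a + b) u = ip a u + ip b u.
Proof. exact: linearDl. Qed.

Lemma ipZl (t : R) a u : ip (t *: a) u = t * ip a u.
Proof. exact: linearZl_LR. Qed.

Lemma ipNl a u : ip (- a) u = - ip a u.
Proof. by rewrite -scaleN1r ipZl mulN1r. Qed.

Lemma ipBl u a b : ip (a - b) u = ip a u - ip b u.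
Proof. by rewrite ipDl ipNl. Qed.

Lemma ipDr u a b : ip u (a + b) = ip u a + ip u b.
Proof. by rewrite ipC ipDl !(ipC u). Qed.

Lemma ipZr (t : R) a u : ip u (t *: a) = t * ip u a.
Proof. by rewrite ipC ipZl (ipC u). Qed.

Lemma ipBr u a b : ip u (a - b) = ip u a - ip u b.
Proof. by rewrite ipC ipBl !(ipC u). Qed.

Lemma ipNr a u : ip a (- u) = - ip a u.
Proof. by rewrite ipC ipNl (ipC u). Qed.

Let ipE := (ipDl, ipNl, ipZl, ipDr, ipNr, ipZr).

Lemma sqr_normD a b : `|a + b| ^+ 2 = `|a| ^+ 2 + 2 * ip a b + `|b| ^+ 2.
Proof. by rewrite -!ip_norm ipDl !ipDr (ipC b a); ring. Qed.

Lemma sqr_normB a b : `|a - b| ^+ 2 = `|a| ^+ 2 - 2 * ip a b + `|b| ^+ 2.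
Proof. by rewrite -!ip_norm ipBl !ipBr (ipC b a); ring. Qed.

(** Cauchy-Schwarz is the square of the triangle inequality. *)
Lemma ip_le a b : ip a b <= `|a| * `|b|.
Proof.
have := lerXn2r 2 (normr_ge0 (a + b)) (addr_ge0 (normr_ge0 a) (normr_ge0 b))
  (ler_normD a b).
by rewrite sqr_normD => h; lra.
Qed.

Lemma normr_ip_le a b : `|ip a b| <= `|a| * `|b|.
Proof.
by rewrite ler_norml ip_le andbT lerNl -ipNl (le_trans (ip_le _ _))// normrN.
Qed.

Lemma ip_dual h : dual (ip h : H -> R).
Proof.
apply: (@bounded_linear_mapP _ _ _ _ `|h|) => [a u v|v]; last exact: normr_ip_le.
by rewrite ipDr ipZr.
Qed.

Variable K : set H.
Hypotheses (K_neq0 : K !=set0) (K_closed : closed K) (K_convex : convex_set K).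

Lemma dist_le h a : K a -> dist K h <= `|h - a|.
Proof. by move=> Ka; apply: ge_inf; [exists 0 => _ [b _ <-]|exists a]. Qed.

Lemma dist_ge0 h : 0 <= dist K h.
Proof.
apply: lb_le_inf => [|_ [a _ <-]//]; have [a Ka] := K_neq0.
by exists `|h - a|, a.
Qed.

(* The parallelogram law at h - a and h - b: minimising sequences are Cauchy. *)
Let midpoint h a b : K a -> K b ->
  `|a - b| ^+ 2 <= 2 * `|h - a| ^+ 2 + 2 * `|h - b| ^+ 2 - 4 * dist K h ^+ 2.
Proof.
move=> Ka Kb.
have Km : K (2^-1 *: a + 2^-1 *: b) by apply: convex_comb => //; lra.
have hm := dist_le h Km.
have {hm} : dist K h ^+ 2 <= `|h - (2^-1 *: a + 2^-1 *: b)| ^+ 2.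
  by rewrite ler_pXn2r ?nnegrE ?dist_ge0.
rewrite -!ip_norm !ipE (ipC b a) (ipC a h) (ipC b h).
by move=> h1; lra.
Qed.

Lemma proj_exists h : exists p, K p /\ forall a, K a -> `|h - p| <= `|h - a|.
Proof.
have d0 := dist_ge0 h; set d := dist K h in d0 *.
have e_gt0 n : 0 < 2^-1 ^+ n :> R by rewrite exprn_gt0 ?invr_gt0.
have /choice[a aP] n : exists a, K a /\ `|h - a| < d + 2^-1 ^+ n.
  have [|_ [a Ka <-] ad] := @inf_adherent _ [set `|h - a| | a in K] _ (e_gt0 n).
    split; last by exists 0 => _ [b _ <-].
    by have [a Ka] := K_neq0; exists `|h - a|, a.
  by exists a.
have e_cvg : 2^-1 ^+ n @[n --> \oo] --> (0 : R).
  by apply: cvg_expr; rewrite ger0_norm; lra.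
have sq n : `|h - a n| ^+ 2 <= d ^+ 2 + (2 * d + 1) * 2^-1 ^+ n.
  have [_ /ltW/(lerXn2r 2)] := aP n; rewrite !nnegrE => /(_ (normr_ge0 _)).
  rewrite addr_ge0 ?(ltW (e_gt0 _))// => /(_ isT)/le_trans; apply.
  rewrite sqrrD -addrA lerD2l mulrDl mul1r.
  rewrite -mulr_natl mulrA lerD2l expr2 ler_piMl ?(ltW (e_gt0 _))//.
  by rewrite exprn_ile1//; lra.
have a_cvg : cvg (a n @[n --> \oo]).
  apply/cauchy_cvgP/cauchy_exP => eps eps0.
  have C_gt0 : 0 < 4 * (2 * d + 1) by lra.
  have [N _ hN] : \forall n \near \oo,
      2^-1 ^+ n < eps ^+ 2 / (4 * (2 * d + 1)) :> R.
    by apply: (cvgr_lt (0 : R) e_cvg); rewrite divr_gt0// exprn_gt0.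
  exists (a N), N => // n /= Nn.
  rewrite -ball_normE /= -(ltr_pXn2r (ltn0Sn 1))/= ?nnegrE ?(ltW eps0)//.
  apply: le_lt_trans (midpoint h (aP N).1 (aP n).1) _.
  have := hN N (leqnn N); have := hN n Nn; have := sq n; have := sq N.
  rewrite -/d /= !ltr_pdivlMr// => h1 h2 h3 h4; lra.
pose p := lim (a n @[n --> \oo]).
have ap : a n @[n --> \oo] --> p := a_cvg.
have Kp : K p.
  by apply: (closed_cvg _ K_closed _ _ ap); apply: nearW => n; have [] := aP n.
exists p; split=> // b Kb; apply: le_trans (dist_le h Kb); rewrite -/d.
have : `|h - a n| - 2^-1 ^+ n @[n --> \oo] --> `|h - p| - 0.
  by apply: cvgB => //; apply: cvg_norm; apply: cvgB => //; exact: cvg_cst.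
rewrite subr0 => /cvgr_to_le; apply; apply: nearW => n.
by have [_ /ltW] := aP n; rewrite lerBlDr.
Qed.

Lemma projP h : K (proj K h) /\ forall a, K a -> `|h - proj K h| <= `|h - a|.
Proof. exact: (xgetPex _ (proj_exists h)). Qed.

Lemma dist_proj h : dist K h = `|h - proj K h|.
Proof.
apply/eqP; rewrite eq_le dist_le/=; last exact: (projP h).1.
apply: lb_le_inf => [|_ [a Ka <-]]; last exact: (projP h).2.
by have [a Ka] := K_neq0; exists `|h - a|, a.
Qed.

(** Moving from the projection p towards a by the fraction t changes the squared
    distance to h by - 2 t < h - p , a - p > + t^2 |a - p|^2, which would be
    negative for small t if the pairing were positive. *)
Lemma proj_variational h a : K a -> ip (h - proj K h) (a - proj K h) <= 0.
Proof.
move=> Ka; have [Kp ph] := projP h; set p := proj K h in Kp ph *.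
rewrite leNgt; apply/negP; set c := ip _ _ => c0.
set D := `|a - p| ^+ 2; have D0 : 0 <= D by exact: exprn_ge0.
(* This t is at most 1 and satisfies t D < c. *)
pose t := c / (D + c); have Dc0 : 0 < D + c by lra.
have t0 : 0 < t by rewrite divr_gt0.
have t1 : t <= 1 by rewrite ler_pdivrMr//; lra.
have Kt : K (t *: a + (1 - t) *: p) by apply: convex_comb => //; lra.
have := lerXn2r 2 (normr_ge0 _) (normr_ge0 _) (ph _ Kt).
have -> : h - (t *: a + (1 - t) *: p) = (h - p) - t *: (a - p).
  rewrite scalerBl scale1r scalerBr !opprD !opprK !addrA addrAC [in RHS]addrAC.
  by rewrite -!addrA; congr (_ + _); rewrite addrCA [in RHS]addrC -addrA.
rewrite (sqr_normB (h - p)) ipZr -/c normrZ exprMn -/D (ger0_norm (ltW t0)).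
have tE : t * (D + c) = c by rewrite divfK// gt_eqF.
have h1 : t ^+ 2 * D = t * c - t ^+ 2 * c by rewrite -[in t * c]tE; ring.
have h2 : 0 < t * c by rewrite mulr_gt0.
have h3 : 0 < t ^+ 2 * c by rewrite mulr_gt0 ?exprn_gt0.
by rewrite h1; lra.
Qed.

Lemma proj_monotone h h' :
  `|proj K h - proj K h'| ^+ 2 <= ip (h - h') (proj K h - proj K h').
Proof.
have := proj_variational h (projP h').1; have := proj_variational h' (projP h).1.
rewrite -ip_norm !ipE; set p := proj K h; set p' := proj K h'.
by rewrite (ipC p' p) => h1 h2; lra.
Qed.

Lemma proj_nonexpansive h h' : `|proj K h - proj K h'| <= `|h - h'|.
Proof.
have := le_trans (proj_monotone h h') (ip_le _ _).
have [->|p0] := eqVneq (proj K h - proj K h') 0; first by rewrite normr0.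
by rewrite expr2 ler_pM2r// normr_gt0.
Qed.

(** Compare e + h with the projection of h for the upper bound, and h with the
    projection of e + h for the lower one; nonexpansiveness replaces the second
    projection by the first at the cost of |e|^2. *)
Lemma sqr_dist_expansion h e :
  `|dist K (e + h) ^+ 2 - dist K h ^+ 2 - 2 * ip (h - proj K h) e| <= `|e| ^+ 2.
Proof.
have pe := proj_nonexpansive (e + h) h; rewrite addrK in pe.
have e2 : ip (proj K (e + h) - proj K h) e <= `|e| ^+ 2.
  by apply: le_trans (ip_le _ _) _; rewrite expr2 ler_wpM2r.
have hi : dist K (e + h) ^+ 2 <= `|e + h - proj K h| ^+ 2.
  by rewrite ler_pXn2r ?nnegrE ?dist_ge0// dist_le//; exact: (projP h).1.
have lo : dist K h ^+ 2 <= `|h - proj K (e + h)| ^+ 2.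
  by rewrite ler_pXn2r ?nnegrE ?dist_ge0// dist_le//; exact: (projP _).1.
move: hi lo e2; rewrite (dist_proj (e + h)) (dist_proj h).
rewrite -!ip_norm !ipE.
set p := proj K h; set q := proj K (e + h).
rewrite !(ipC h e) !(ipC p e) !(ipC q e) !(ipC p h) !(ipC q h) => hi lo e2.
by rewrite ler_norml; apply/andP; split; lra.
Qed.

Lemma diff_sqr_dist h :
  differentiable (fun h => dist K h ^+ 2) h /\
  'd (fun h => dist K h ^+ 2) h = (fun e => 2 * ip (h - proj K h) e) :> (H -> R).
Proof.
apply: (@differentiable_quadratic_remainder _ _ _ _ _ _ 1) => [|e]; last first.
  by rewrite mul1r; exact: sqr_dist_expansion.
apply: (@bounded_linear_mapP _ _ _ _ (2 * `|h - proj K h|)) => [a u v|v].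
  by rewrite ipDr ipZr -[_ *: _]/(_ * _); ring.
by rewrite normrM ger0_norm// -mulrA ler_wpM2l// normr_ip_le.
Qed.

End hilbert_projection.

(** * Penalty parameters and passage to the limit *)

Section penalty.
Context {R : realType}.
Variables (gamma tau : R) (rho v : nat -> R).
Hypotheses (gamma_gt1 : 1 < gamma) (tau_gt0 : 0 < tau) (tau_lt1 : tau < 1).
Hypothesis rho0_gt0 : 0 < rho 0%N.
Hypothesis v_ge0 : forall k, 0 <= v k.
Hypothesis rhoS : forall k,
  rho k.+1 = if (k == 0%N) || (v k <= tau * v k.-1) then rho k else gamma * rho k.

Let gamma_gt0 : 0 < gamma. Proof. exact: lt_trans ltr01 gamma_gt1. Qed.

Lemma penalty_gt0 k : 0 < rho k.
Proof.
by elim: k => // k IH; rewrite rhoS; case: ifP => // _; rewrite mulr_gt0.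
Qed.

Let penalty_nd : nondecreasing_seq rho.
Proof.
apply/nondecreasing_seqP => k; rewrite rhoS; case: ifP => // _.
by rewrite ler_peMl ?ltW// penalty_gt0.
Qed.

(** Either the decrease test succeeds from some step on and v decays like tau^n,
    or it fails infinitely often and each failure multiplies rho by gamma. *)
Lemma penalty_dichotomy :
  (rho k)^-1 @[k --> \oo] --> (0 : R) \/ v k @[k --> \oo] --> (0 : R).
Proof.
have [[k0 small]|fails] := pselect (exists k0, forall k, (k0 <= k)%N ->
    (k == 0%N) || (v k <= tau * v k.-1)).
  right; have v_geo n : v (n + k0)%N <= tau ^+ n * v k0.
    elim: n => [|n IH]; first by rewrite expr0 mul1r.
    have := small (n.+1 + k0)%N (leq_addl _ _); rewrite addSn /= => h.
    by apply: le_trans h _; rewrite exprS -mulrA ler_wpM2l// ltW.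
  rewrite -(cvg_shiftn k0).
  apply: (@squeeze_cvgr _ _ _ _ (fun=> 0) (fun n => tau ^+ n * v k0)).
  - by apply: nearW => n; rewrite v_ge0 v_geo.
  - exact: cvg_cst.
  - rewrite -[X in _ --> X](mul0r (v k0)); apply: cvgM; last exact: cvg_cst.
    by apply: cvg_expr; rewrite ger0_norm// ltW.
left; have rho_geo n : exists k, gamma ^+ n * rho 0%N <= rho k.
  elim: n => [|n [k nk]]; first by exists 0%N; rewrite expr0 mul1r.
  have [l [kl lP]] : exists l, (k <= l)%N /\
      (l == 0%N) || (v l <= tau * v l.-1) = false.
    apply: contrapT => h; apply: fails; exists k => l kl.
    by apply: contrapT => /negP/negbTE lP; apply: h; exists l.
  exists l.+1; rewrite rhoS lP exprS -mulrA ler_wpM2l ?(ltW gamma_gt0)//.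
  exact: le_trans nk (penalty_nd kl).
apply/cvgrPdist_lt => e e0.
have g_cvg : gamma^-1 ^+ n * (rho 0%N)^-1 @[n --> \oo] --> 0 * (rho 0%N)^-1.
  apply: cvgM; last exact: cvg_cst.
  by apply: cvg_expr; rewrite normfV (ger0_norm (ltW gamma_gt0)) invf_lt1.
rewrite mul0r in g_cvg.
have [N _ /(_ N (leqnn N)) /= hN] : \forall n \near \oo,
    gamma^-1 ^+ n * (rho 0%N)^-1 < e by exact: (cvgr_lt (0 : R) g_cvg).
have [k hk] := rho_geo N; exists k => // m /= km.
rewrite sub0r normrN ger0_norm ?invr_ge0 ?(ltW (penalty_gt0 _))//.
apply: le_lt_trans hN; rewrite exprVn -invfM lef_pV2 ?posrE ?penalty_gt0//.
  by apply: le_trans (penalty_nd km).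
by rewrite mulr_gt0// exprn_gt0.
Qed.

End penalty.

Section limits.
Context {R : realType}.

(** The subproblem gives information on the iterates of positive index only, so
    the subsequence is written with indices g j + 1. *)
Lemma weak_limit_point_tail (U : normedModType R) (u : nat -> U) (l : U) :
  weak_limit_point u l -> exists2 g : nat -> nat,
    g @ \oo --> \oo & weak_cvg (fun j => u (g j).+1) l.
Proof.
move=> [f f_inc ul].
have f_lt n m : (n < m)%N -> (f n < f m)%N.
  by have := f_inc m n; rewrite leEnat !ltnNge => ->.
have f_ge n : (n <= f n)%N.
  by elim: n => // n IH; apply: leq_ltn_trans IH _; exact: f_lt.
exists (fun j => (f j.+1).-1).
  move=> A [N _ NA]; exists N => // j /= Nj; apply: NA => /=.
  by have := f_ge j.+1; case: (f j.+1) => //= m jm; exact: leq_trans Nj jm.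
move=> psi dpsi.
have -> : (fun j => psi (u (f j.+1).-1.+1)) = (fun j => psi (u (f (j + 1)%N))).
  by apply/funext => j; rewrite addn1 prednK// (leq_ltn_trans _ (f_lt j j.+1 _)).
have := ul psi dpsi.
by rewrite -(cvg_shiftn 1).
Qed.

Lemma weak_cvg_diag (U : normedModType R) (u : nat -> U) (l : U) :
  weak_cvg u l -> weak_cvg (fun j => (u j, u j)) (l, l).
Proof.
move=> ul psi dpsi.
suff bd : bounded_linear_map (fun z : U => (z, z)).
  exact: (ul _ (blmap_comp bd dpsi)).
by split=> // z; apply: cvg_pair; exact: cvg_id.
Qed.

Lemma weak_cvgBl (U : normedModType R) (u : nat -> U) (l c : U) :
  weak_cvg u l -> weak_cvg (fun j => c - u j) (c - l).
Proof.
move=> ul psi dpsi; rewrite (blmapB dpsi).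
under eq_fun do rewrite (blmapB dpsi).
by apply: cvgB; [exact: cvg_cst|exact: ul].
Qed.

(** The sequence h_ is bounded, so replacing q_ by q and D_ by D changes the
    pairing by a null sequence; what remains is a fixed bounded functional,
    evaluated along a weakly convergent sequence. *)
Lemma weak_strong_pairing (U : normedModType R) (H : completeNormedModType R)
    (ip : {dot H for (idfun : R -> R)})
    (ip_norm : forall h : H, ip h h = `|h| ^+ 2)
    (D_ : nat -> U -> H) (D : U -> H) (o : nat -> R)
    (q_ : nat -> H) (q : H) (h_ : nat -> U) (h : U) :
  bounded_linear_map D -> (forall j v, `|D_ j v - D v| <= o j * `|v|) ->
  o j @[j --> \oo] --> (0 : R) -> q_ j @[j --> \oo] --> q -> weak_cvg h_ h ->
  ip (q_ j) (D_ j (h_ j)) @[j --> \oo] --> ip q (D h).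
Proof.
move=> bD DD o0 qq hh; have [M hM] := weak_cvg_bounded hh.
have M0 : 0 <= M by exact: le_trans (hM 0%N).
have [k k0 Dk] := blmap_lipschitz bD.
have s_cvg : ip q (D (h_ j)) @[j --> \oo] --> ip q (D h).
  exact: (hh _ (blmap_comp bD (ip_dual ip_norm q))).
have Dh_le j : `|D_ j (h_ j) - D (h_ j)| <= `|o j| * M.
  apply: le_trans (DD _ _) _; apply: le_trans (ler_norm _) _.
  by rewrite normrM normr_id ler_wpM2l.
pose b j := `|q_ j - q| * (k * M + `|o j| * M) + `|q| * (`|o j| * M).
have b0 : b j @[j --> \oo] --> (0 : R).
  have on0 : `|o j| @[j --> \oo] --> (0 : R).
    by rewrite -[X in _ --> X](@normr0 _ R); exact: cvg_norm.
  have qn0 : `|q_ j - q| @[j --> \oo] --> (0 : R).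
    rewrite -[X in _ --> X](@normr0 _ H) -[X in `|X|](subrr q).
    by apply: cvg_norm; apply: cvgB => //; exact: cvg_cst.
  have oM0 : `|o j| * M @[j --> \oo] --> (0 : R).
    by rewrite -[X in _ --> X](mul0r M); apply: cvgM => //; exact: cvg_cst.
  rewrite (_ : 0 = 0 * (k * M + 0) + `|q| * 0); last by rewrite mul0r mulr0 addr0.
  apply: cvgD; apply: cvgM => //; last exact: cvg_cst.
  by apply: cvgD => //; exact: cvg_cst.
have t_le j : `|ip (q_ j) (D_ j (h_ j)) - ip q (D (h_ j))| <= b j.
  have -> : ip (q_ j) (D_ j (h_ j)) - ip q (D (h_ j)) =
      ip (q_ j - q) (D_ j (h_ j)) + ip q (D_ j (h_ j) - D (h_ j)).
    by rewrite ipBl ipBr; ring.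
  apply: le_trans (ler_normD _ _) _; apply: lerD.
    apply: le_trans (normr_ip_le ip_norm _ _) _; rewrite ler_wpM2l//.
    rewrite -[X in `|X|](subrK (D (h_ j))) addrC.
    apply: le_trans (ler_normD _ _) _; apply: lerD => //.
    by apply: le_trans (Dk _) _; rewrite ler_wpM2l// ltW.
  by apply: le_trans (normr_ip_le ip_norm _ _) _; rewrite ler_wpM2l.
rewrite -[X in _ --> X]add0r.
rewrite (_ : (fun _ => _) = fun j =>
  (ip (q_ j) (D_ j (h_ j)) - ip q (D (h_ j))) + ip q (D (h_ j))); last first.
  by apply/funext => j; rewrite subrK.
apply: cvgD => //; apply: (@squeeze_cvgr _ _ _ _ (fun j => - b j) b) => //.
  by apply: nearW => j; rewrite -ler_norml.
by rewrite -[X in _ --> X]oppr0; exact: cvgN.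
Qed.

(** In the application r is the inverse penalty parameter and e_ collects the
    inexactness and the operator F: bounded functionals which the factor r
    removes in the limit. *)
Lemma vanishing_residual_limit (U : normedModType R) (H : completeNormedModType R)
    (ip : {dot H for (idfun : R -> R)})
    (ip_norm : forall h : H, ip h h = `|h| ^+ 2)
    (D_ : nat -> U -> H) (D : U -> H) (o : nat -> R)
    (q_ : nat -> H) (q : H) (h_ : nat -> U) (h : U)
    (e_ : nat -> U -> R) (r : nat -> R) (M : R) :
  bounded_linear_map D -> (forall j v, `|D_ j v - D v| <= o j * `|v|) ->
  o j @[j --> \oo] --> (0 : R) -> q_ j @[j --> \oo] --> q -> weak_cvg h_ h ->
  (forall j v, `|e_ j v| <= M * `|v|) -> r j @[j --> \oo] --> (0 : R) ->
  (forall j, r j * e_ j (h_ j) <= ip (q_ j) (D_ j (h_ j))) ->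
  0 <= ip q (D h).
Proof.
move=> bD DD o0 qq hh eM r0 re.
have pairing := weak_strong_pairing ip_norm bD DD o0 qq hh.
have [N hN] := weak_cvg_bounded hh.
have lower j : - (`|r j| * (`|M| * N)) <= ip (q_ j) (D_ j (h_ j)).
  apply: le_trans (re j); rewrite lerNl; apply: le_trans (ler_norm _) _.
  rewrite normrN normrM ler_wpM2l//; apply: le_trans (eM _ _) _.
  apply: le_trans (ler_wpM2r (normr_ge0 _) (ler_norm M)) _.
  by rewrite ler_wpM2l.
have lower_cvg : - (`|r j| * (`|M| * N)) @[j --> \oo] --> (0 : R).
  rewrite -[X in _ --> X]oppr0 -[X in - X](mul0r (`|M| * N)).
  apply: cvgN; apply: cvgM; last exact: cvg_cst.
  by rewrite -[X in _ --> X](@normr0 _ R); exact: cvg_norm.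
by apply: (ler_cvg_to lower_cvg pairing); exact: nearW.
Qed.

End limits.

(** * Stationarity and feasibility of the weak limit points *)

(** Write 0 = z + i (DG (c - xbar)) - i k with c in C and k in K. Then
      |q|^2 + < q , i (DG (c - xbar)) > = < q , i k - P z > <= 0
    for q = z - P z, and the second term on the left is nonnegative. *)
Lemma ERCQ_stationary_feasible (R : realType) (X Y : normedModType R)
    (H : completeNormedModType R) (ip : {dot H for (idfun : R -> R)})
    (ip_norm : forall h : H, ip h h = `|h| ^+ 2)
    (i : Y -> H) (C : set X) (K : set Y) (Kc : set H) (G : X * X -> Y)
    (xbar : X) :
  bounded_linear_map i -> Kc !=set0 -> closed Kc -> convex_set Kc ->
  i @^-1` Kc = K ->
  let z := i (G (xbar, xbar)) in
  (forall c, C c -> 0 <= ip (z - proj Kc z) (i (Dy G (xbar, xbar) (c - xbar)))) ->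
  ERCQ G C K xbar -> K (G (xbar, xbar)).
Proof.
move=> bi Kc_neq0 Kc_closed Kc_convex Kc_K z key.
move=> /interior_subset[c Cc [k Kk ck]].
have [Kp _] := projP ip_norm Kc_neq0 Kc_closed Kc_convex z.
have Kik : Kc (i k) by move: Kk; rewrite -Kc_K.
rewrite -Kc_K /preimage /= -/z.
have := proj_variational ip_norm Kc_neq0 Kc_closed Kc_convex z Kik.
have : i (G (xbar, xbar) + Dy G (xbar, xbar) (c - xbar) - k) = 0.
  by rewrite ck (blmap0 bi).
rewrite (blmapB bi) (blmapD bi) -/z => /subr0_eq <-.
rewrite addrAC ipDr ip_norm => zp; have := key c Cc => zD.
have zp0 : `|z - proj Kc z| ^+ 2 <= 0 by lra.
suff -> : z = proj Kc z by [].
apply: subr0_eq; apply/normr0_eq0/eqP.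
by rewrite -sqrf_eq0 eq_le zp0 exprn_ge0.
Qed.

Theorem lemma7p3 (R : realType) (X Y H : completeNormedModType R)
    (ip : {dot H for (idfun : R -> R)})
    (ip_norm : forall h : H, ip h h = `|h| ^+ 2)
    (i : Y -> H)
    (i_linear : linear i) (i_continuous : continuous i)
    (i_injective : injective i) (i_dense : dense (range i))
    (C : set X)
    (C_neq0 : C !=set0) (C_closed : closed C) (C_convex : convex_set C)
    (K : set Y)
    (K_neq0 : K !=set0) (K_closed : closed K) (K_convex : convex_set K)
    (Kc : set H)
    (Kc_closed : closed Kc) (Kc_convex : convex_set Kc)
    (Kc_K : i @^-1` Kc = K)
    (F : X -> X -> R) (F_dual : forall x, dual (F x))
    (G : X * X -> Y)
    (G_diff : forall x y, differentiable (fun z => G (x, z)) y)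
    (gamma tau : R) (gamma_gt1 : 1 < gamma) (tau_gt0 : 0 < tau) (tau_lt1 : tau < 1)
    (B : set H) (B_bounded : bounded_set B)
    (x : nat -> X) (lam w : nat -> H) (rho : nat -> R)
    (alm : alm_sequences i Kc G gamma tau B x lam w rho)
    (F_bounded : bounded_operator F) (F_pseudomonotone : pseudomonotone F)
    (G_cc : completely_continuous G) (DyG_cc : completely_continuous_op (Dy G))
    (eps : nat -> X -> R) (eps_dual : forall k, dual (eps k))
    (eps_cvg0 : opnorm (eps k) @[k --> \oo] --> (0 : R))
    (x_subproblem : forall k, C (x k.+1) /\
      normal_cone C (x k.+1)
        (eps k.+1 \- aug_lagrangian ip i Kc F G (rho k) (x k.+1) (w k)))
    (xbar : X) (xbar_limit : weak_limit_point x xbar) :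
  let d2G := fun z : X * X => dist Kc (i (G z)) ^+ 2 in
  [/\ C xbar,
      differentiable (fun y => d2G (xbar, y)) xbar,
      normal_cone C xbar (\- Dy d2G (xbar, xbar)) &
      ERCQ G C K xbar -> C xbar /\ K (G (xbar, xbar))].
Proof.
move=> d2G.
have [rho0 wB _ rhoS] := alm.
have bi : bounded_linear_map i by [].
have bDG u v : bounded_linear_map (Dy G (u, v)).
  split; last exact: diff_continuous (G_diff u v).
  by move=> a s t; rewrite /Dy linearP.
have Kc_neq0 : Kc !=set0.
  by have [k] := K_neq0; rewrite -Kc_K => ik; exists (i k).
have [g g_oo ug] := weak_limit_point_tail xbar_limit.
set u := fun j => x (g j).+1 in ug.
have uC j : C (u j) by have [] := x_subproblem (g j).
have Cxbar : C xbar := closed_convex_weakly_closed C_closed C_convex uC ug.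
have Gu : i (G (u j, u j)) @[j --> \oo] --> i (G (xbar, xbar)).
  apply: continuous_cvg; first exact: i_continuous.
  exact: G_cc (weak_cvg_diag ug).
have DGu : opnorm (Dy G (u j, u j) \- Dy G (xbar, xbar)) @[j --> \oo] --> (0 : R).
  exact: DyG_cc (weak_cvg_diag ug).
set z := i (G (xbar, xbar)) in Gu.
pose P := proj Kc; pose q := z - P z.
pose D s := i (Dy G (xbar, xbar) s).
have bD : bounded_linear_map D by exact: (blmap_comp (bDG _ _) bi).
have PKc h : Kc (P h) by exact: (projP ip_norm Kc_neq0 Kc_closed Kc_convex h).1.
have P_fix h : Kc h -> P h = h.
  move=> Kh; apply/eqP; rewrite eq_sym -subr_eq0 -normr_le0.
  rewrite -(@normr0 _ H) -(subrr h).
  exact: (projP ip_norm Kc_neq0 Kc_closed Kc_convex h).2.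
have stationary c : C c -> 0 <= ip q (D (c - xbar)).
  move=> Cc.
  pose v k := violation i Kc G (x k.+1) (w k) (rho k).
  have rhoS' k : rho k.+1 =
      if (k == 0%N) || (v k <= tau * v k.-1) then rho k else gamma * rho k.
    by rewrite rhoS; case: k.
  have v0 k : 0 <= v k by exact: normr_ge0.
  have rho_gt0 := penalty_gt0 gamma_gt1 rho0 rhoS'.
  have [r0|v_to0] :=
    penalty_dichotomy gamma_gt1 tau_gt0 tau_lt1 rho0 v0 rhoS'; last first.
    (* The projections p j are at distance v (g j) from the constraint values. *)
    suff Kz : Kc z by rewrite /q P_fix// subrr -(scale0r z) ipZl mul0r.
    pose p j := proj Kc (shifted i G (u j) (w (g j)) (rho (g j))).
    have pz : p j @[j --> \oo] --> z.
      rewrite (_ : p =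
        fun j => i (G (u j, u j)) - (i (G (u j, u j)) - p j)); last first.
        by apply/funext => j; rewrite subKr.
      rewrite -[X in _ --> X]subr0; apply: cvgB => //.
      apply/norm_cvg0P; exact: (cvg_comp _ _ g_oo v_to0).
    apply: (closed_cvg _ Kc_closed _ _ pz); apply: nearW => j; exact: PKc.
  pose r j := (rho (g j))^-1.
  have rj0 : r j @[j --> \oo] --> (0 : R) by exact: (cvg_comp _ _ g_oo r0).
  pose sh j := shifted i G (u j) (w (g j)) (rho (g j)).
  have [W wW] := bounded_near_ex B_bounded.
  have shz : sh j @[j --> \oo] --> z.
    rewrite -[X in _ --> X]addr0; apply: cvgD => //.
    apply/norm_cvg0P; apply: (@squeeze_cvgr _ _ _ _ (fun=> 0) (fun j => r j * W)).
    - have r_ge0 j : 0 <= r j by rewrite invr_ge0 ltW.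
      apply: nearW => j; rewrite normr_ge0 normrZ (ger0_norm (r_ge0 j)).
      by rewrite ler_wpM2l// wW.
    - exact: cvg_cst.
    - by rewrite -[X in _ --> X](mul0r W); apply: cvgM => //; exact: cvg_cst.
  pose q_ j := sh j - P (sh j).
  have qq : q_ j @[j --> \oo] --> q.
    apply: cvgB => //; apply/cvgrPdist_le => e e0.
    have /cvgrPdist_le/(_ e e0) := shz; apply: filterS => j; apply: le_trans.
    exact: proj_nonexpansive.
  pose h_ j := c - u j.
  have hh : weak_cvg h_ (c - xbar) := @weak_cvgBl _ _ _ _ c ug.
  have [Ci Ci0 iCi] := blmap_lipschitz bi.
  have [M uM] := weak_cvg_bounded ug.
  have [M2 FM2] : exists M2, forall j, opnorm (F (u j)) <= M2.
    have uB : bounded_set (range u).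
      exists M; split=> [|m Mm _ [j _ <-]]; first exact: num_real.
      exact: le_trans (uM j) (ltW Mm).
    have [M2 FM2] := bounded_near_ex (F_bounded _ uB).
    exists M2 => j; apply: le_trans (ler_norm _) _; apply: FM2.
    by exists (u j) => //; exists j.
  have [E eE] : exists E, forall k, opnorm (eps k) <= E.
    have [E eE] := bounded_near_ex (cvg_seq_bounded (cvgP _ eps_cvg0)).
    by exists E => k; apply: le_trans (ler_norm _) _; exact: eE.
  pose o j := Ci * opnorm (Dy G (u j, u j) \- Dy G (xbar, xbar)).
  have Do j s : `|i (Dy G (u j, u j) s) - D s| <= o j * `|s|.
    rewrite -(blmapB bi) -mulrA; apply: le_trans (iCi _) _.
    rewrite ler_wpM2l ?(ltW Ci0)//.
    exact: (le_opnorm (blmapB_fun (bDG (u j) (u j)) (bDG xbar xbar))).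
  have o0 : o j @[j --> \oo] --> (0 : R).
    by rewrite -[X in _ --> X](mulr0 Ci); apply: cvgM => //; exact: cvg_cst.
  pose e_ j s := eps (g j).+1 s - F (u j) s.
  have e_le j s : `|e_ j s| <= (E + M2) * `|s|.
    apply: le_trans (ler_normB _ _) _; rewrite mulrDl; apply: lerD.
      by apply: le_trans (le_opnorm (eps_dual _) s) _; rewrite ler_wpM2r.
    by apply: le_trans (le_opnorm (F_dual _) s) _; rewrite ler_wpM2r.
  apply: (vanishing_residual_limit ip_norm bD Do o0 qq hh e_le rj0) => j.
  have [_ [_ /(_ c Cc)]] := x_subproblem (g j).
  rewrite /aug_lagrangian /dual_of_H /= -/(u j) -/(h_ j) -/(sh j) -/(q_ j).
  rewrite /r ler_pdivrMl// /e_ => ineq.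
  by lra.
have iG_diff : differentiable (fun y => i (G (xbar, y))) xbar /\
    'd (fun y => i (G (xbar, y))) xbar = D :> (X -> H).
  pose I : {linear Y -> H} := HB.pack i (GRing.isLinear.Build _ _ _ _ i i_linear).
  have dI y : differentiable I y by exact: linear_differentiable.
  split; first exact: (differentiable_comp (G_diff xbar xbar) (dI _)).
  by rewrite (diff_comp (G_diff xbar xbar) (dI _)) diff_lin.
have [d_diff dE] := diff_sqr_dist ip_norm Kc_neq0 Kc_closed Kc_convex z.
have d2G_diff : differentiable (fun y => d2G (xbar, y)) xbar.
  exact: (differentiable_comp iG_diff.1 d_diff).
have d2GE s : Dy d2G (xbar, xbar) s = 2 * ip q (D s).
  rewrite /Dy /= (diff_comp iG_diff.1 d_diff) /= iG_diff.2.
  by rewrite dE.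
split=> //.
  split.
    split=> [a s t|s]; last first.
      by apply: continuousN; exact: (diff_continuous d2G_diff).
    by rewrite /= /Dy linearP scalerN opprD.
  by move=> c Cc /=; rewrite d2GE oppr_le0 mulr_ge0// stationary.
split=> //.
exact: (ERCQ_stationary_feasible ip_norm bi Kc_neq0 Kc_closed Kc_convex Kc_K
  stationary).
Qed.
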